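(* Let $G=\mathrm{GL}(n,\mathbb{R})$ be equipped with the left invariant Riemannian metric determined by the Frobenius inner product $\langle X,Y\rangle=\mathrm{tr}(X^\top Y)$ on $\mathfrak{g}=\mathfrak{gl}(n,\mathbb{R})$. Let $u,v\in\mathfrak{g}$ be linearly independent, and let $S(u,v)$ denote the sectional curvature of the section spanned by $u$ and $v$. Assume either of the following two conditions: (i) both $u$ and $v$ are symmetric; or (ii) either $u$ or $v$ is skew-symmetric. Then $[u,v]=0$ if and only if $S(u,v)=0$.
   Context: The Lie algebra $\mathfrak{g}=\mathfrak{gl}(n,\mathbb{R})$ is the space of $n\times n$ real matrices with bracket $[u,v]=uv-vu$. An element $u\in\mathfrak{g}$ is also identified with the left invariant vector field on $G$ whose value at the identity is $u$. $\nabla$ is the Levi-Civita connection; for left invariant fields it is given by $\langle\nabla_uv,w\rangle=\frac12(\langle[u,v],w\rangle-\langle[v,w],u\rangle-\langle[u,w],v\rangle)$, equivalently $\nabla_uv=\frac12([u,v]+[u,v^\top]+[v,u^\top])$. The curvature tensor is $R(u,v)w=\nabla_u(\nabla_vw)-\nabla_v(\nabla_uw)-\nabla_{[u,v]}w$, and for linearly independent $u,v$ the sectional curvature is $$S(u,v)=\frac{\langle R(u,v)v,u\rangle}{\langle u,u\rangle\langle v,v\rangle-\langle u,v\rangle^2}.$$ *)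

(* Defs.v *)
From mathcomp Require Import all_boot all_order all_algebra.
From mathcomp Require Import reals ring.

Set Implicit Arguments.
Unset Strict Implicit.
Unset Printing Implicit Defensive.

Import Order.TTheory GRing.Theory Num.Theory.
Local Open Scope ring_scope.

Section LeftInvariantGL.
Variables (R : realType) (n : nat).
Implicit Types u v w X Y : 'M[R]_n.

Definition frob X Y : R := \tr (X^T *m Y).

Definition bracket u v : 'M[R]_n := u *m v - v *m u.

(* Right-hand side of the Koszul formula for left invariant fields; the terms
   differentiating inner products vanish because these are constant. *)
Definition koszul u v w : R :=
  2^-1 * (frob (bracket u v) w - frob (bracket v w) u - frob (bracket u w) v).

(* Levi-Civita connection on left invariant fields: the unique matrix whose
   Frobenius product with every w is [koszul u v w].  The elementary matrices
   are orthonormal, so its entries are the values at [delta_mx i j]. *)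
Definition nabla u v : 'M[R]_n :=
  \matrix_(i, j) koszul u v (delta_mx i j).

Definition curvature u v w : 'M[R]_n :=
  nabla u (nabla v w) - nabla v (nabla u w) - nabla (bracket u v) w.

(* The denominator is nonzero exactly when u and v are linearly independent. *)
Definition sectional u v : R :=
  frob (curvature u v v) u / (frob u u * frob v v - frob u v ^+ 2).

Lemma frobC X Y : frob X Y = frob Y X.
Proof. by rewrite /frob -mxtrace_tr trmx_mul trmxK. Qed.

Lemma frob_delta X i j : frob X (delta_mx i j) = X i j.
Proof.
rewrite frobC /frob trmx_delta /mxtrace (bigD1 j) //= big1 => [|k kj].
  rewrite addr0 mxE (bigD1 i) //= big1 => [|l li].
    by rewrite mxE !eqxx mul1r addr0.
  by rewrite mxE (negPf li) andbF mul0r.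
by rewrite mxE big1 // => l _; rewrite mxE (negPf kj) mul0r.
Qed.

Lemma frob_inj X Y : (forall w, frob X w = frob Y w) -> X = Y.
Proof. by move=> h; apply/matrixP => i j; rewrite -!frob_delta h. Qed.

Lemma frobDl X Y w : frob (X + Y) w = frob X w + frob Y w.
Proof. by rewrite /frob linearD /= mulmxDl linearD. Qed.

Lemma frobNl X w : frob (- X) w = - frob X w.
Proof. by rewrite /frob linearN /= mulNmx linearN. Qed.

Lemma frobZl a X w : frob (a *: X) w = a * frob X w.
Proof. by rewrite /frob linearZ /= -scalemxAl linearZ. Qed.

Lemma frob_bracket u v w : frob (bracket v w) u = frob (bracket v^T u) w.
Proof.
rewrite [RHS]frobC /frob /bracket mulmxBr !linearB /= !trmx_mul mulmxBl.
rewrite linearB /= !mulmxA; congr (_ - _).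
by rewrite -(mulmxA v^T) mxtrace_mulC.
Qed.

Lemma koszulE u v w :
  koszul u v w =
  frob (2^-1 *: (bracket u v + bracket u v^T + bracket v u^T)) w.
Proof.
rewrite /koszul (frob_bracket u v w) (frob_bracket v u w) frobZl !frobDl.
by rewrite !frobNl; ring.
Qed.

Lemma nablaE u v :
  nabla u v = 2^-1 *: (bracket u v + bracket u v^T + bracket v u^T).
Proof. by apply/matrixP => i j; rewrite mxE koszulE frob_delta. Qed.

Lemma frob_nabla u v w : frob (nabla u v) w = koszul u v w.
Proof. by rewrite koszulE nablaE. Qed.

Lemma nabla_torsion_free u v : nabla u v - nabla v u = bracket u v.
Proof.
apply: frob_inj => w; rewrite frobDl frobNl !frob_nabla /koszul.
have -> : bracket v u = - bracket u v by rewrite /bracket opprB.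
rewrite frobNl -mulrBr.
set a := frob (bracket u v) w; set b := frob _ u; set c := frob _ v.
by field.
Qed.

Lemma nabla_metric u v w : frob (nabla u v) w + frob v (nabla u w) = 0.
Proof.
rewrite [frob v _]frobC !frob_nabla /koszul -mulrDr.
have -> : bracket w v = - bracket v w by rewrite /bracket opprB.
rewrite frobNl opprK.
set a := frob _ w; set b := frob _ u; set c := frob _ v.
by ring.
Qed.

Lemma nabla_unique (D : 'M[R]_n -> 'M[R]_n -> 'M[R]_n) :
    (forall u v, D u v - D v u = bracket u v) ->
    (forall u v w, frob (D u v) w + frob v (D u w) = 0) ->
  forall u v, D u v = nabla u v.
Proof.
move=> tf mc u v; apply: frob_inj => w; rewrite frob_nabla /koszul.
rewrite -!tf !frobDl !frobNl.
have := mc u v w; have := mc v w u; have := mc w u v.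
rewrite (frobC v (D u w)) (frobC w (D v u)) (frobC u (D w v)).
move=> /eqP; rewrite addr_eq0 => /eqP ->.
move=> /eqP; rewrite addr_eq0 => /eqP ->.
move=> /eqP; rewrite addr_eq0 => /eqP ->.
by field.
Qed.

End LeftInvariantGL.

(* Main.v *)
Require Import Defs.
From mathcomp Require Import all_boot all_order all_algebra.
From mathcomp Require Import reals ring.

Set Implicit Arguments.
Unset Strict Implicit.
Unset Printing Implicit Defensive.

Import Order.TTheory GRing.Theory Num.Theory.
Local Open Scope ring_scope.

(** With [w = [u,v]], compatibility of the connection with the metric writes
    the numerator of the sectional curvature as
    [- <nabla_v v, nabla_u u> + <nabla_u v, nabla_v u> - <nabla_w v, u>].
    This is [- 7/4 |w|^2] when [u] and [v] are symmetric and [1/4 |w|^2] when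
    one of them is skew-symmetric; by Cauchy-Schwarz the denominator is nonzero. *)

Section Curvature.
Variables (R : realType) (n : nat).
Implicit Types u v w X Y : 'M[R]_n.

Lemma frobDr X Y w : frob w (X + Y) = frob w X + frob w Y.
Proof. by rewrite frobC frobDl !(frobC w). Qed.

Lemma frobNr X w : frob w (- X) = - frob w X.
Proof. by rewrite frobC frobNl (frobC w). Qed.

Lemma frobZr a X w : frob w (a *: X) = a * frob w X.
Proof. by rewrite frobC frobZl (frobC w). Qed.

Lemma frob0l w : frob 0 w = 0.
Proof. by rewrite /frob trmx0 mul0mx linear0. Qed.

Lemma frob_tr X Y : frob X^T Y^T = frob X Y.
Proof. by rewrite /frob trmxK -mxtrace_tr trmx_mul !trmxK mxtrace_mulC. Qed.

Lemma frob_sum X : frob X X = \sum_i \sum_j X j i ^+ 2.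
Proof.
by apply: eq_bigr => i _; rewrite mxE; apply: eq_bigr => j _; rewrite mxE expr2.
Qed.

(** A vanishing sum of squares has only zero terms: first each column sum is zero, then each
    entry. *)
Lemma frob_eq0 X : (frob X X == 0) = (X == 0).
Proof.
apply/eqP/eqP => [X0 | ->]; last by rewrite /frob mulmx0 linear0.
apply/matrixP => j i; rewrite mxE; apply/eqP.
rewrite frob_sum in X0.
have sqr_ge0_sum (k : 'I_n) : true -> 0 <= \sum_l X l k ^+ 2.
  by move=> _; apply: sumr_ge0 => l _; rewrite sqr_ge0.
have /psumr_eq0P Xi0 := psumr_eq0P sqr_ge0_sum X0 (i := i) isT.
by rewrite -sqrf_eq0 Xi0 // => l _; rewrite sqr_ge0.
Qed.

(** The vector [<v,v> u - <u,v> v] has squared norm [<v,v>] times this determinant. If the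
    determinant vanished, so would the vector, and [u] would lie on the line of [v], as [v] is
    nonzero. *)
Lemma gram_neq0 u v :
  free [:: u; v] -> frob u u * frob v v - frob u v ^+ 2 != 0.
Proof.
rewrite free_cons span_seq1 free_cons span_nil memv0 => /and3P[uv v0 _].
apply: contra uv => /eqP gram0.
have vv0 : frob v v != 0 by rewrite frob_eq0.
have : frob (frob v v *: u - frob u v *: v) (frob v v *: u - frob u v *: v) == 0.
  rewrite !(frobDl, frobDr, frobNl, frobNr, frobZl, frobZr) (frobC v u).
  apply/eqP; transitivity (frob v v * (frob u u * frob v v - frob u v ^+ 2)).
    by ring.
  by rewrite gram0 mulr0.
rewrite frob_eq0 subr_eq0 => /eqP uE.
apply/vlineP; exists ((frob v v)^-1 * frob u v).
by rewrite -scalerA -uE scalerA mulVf // scale1r.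
Qed.

Lemma bracketC u v : bracket u v = - bracket v u.
Proof. by rewrite /bracket opprB. Qed.

Lemma bracketNr u v : bracket u (- v) = - bracket u v.
Proof. by rewrite /bracket mulmxN mulNmx opprB opprK addrC. Qed.

Lemma bracketNl u v : bracket (- u) v = - bracket u v.
Proof. by rewrite bracketC bracketNr -bracketC. Qed.

Lemma bracket_self u : bracket u u = 0.
Proof. exact: subrr. Qed.

Lemma bracket_tr u v : (bracket u v)^T = bracket v^T u^T.
Proof. by rewrite /bracket linearB /= !trmx_mul. Qed.

Lemma nablaNl u v : nabla (- u) v = - nabla u v.
Proof.
by rewrite !nablaE linearN /= !bracketNl bracketNr -!opprD scalerN.
Qed.

Lemma frob_nabla_skew u v w : frob (nabla u v) w = - frob v (nabla u w).
Proof. by apply/eqP; rewrite -addr_eq0 nabla_metric. Qed.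

Lemma frob_curvature u v :
  frob (curvature u v v) u =
  - frob (nabla v v) (nabla u u) + frob (nabla u v) (nabla v u)
  - frob (nabla (bracket u v) v) u.
Proof.
rewrite /curvature !frobDl !frobNl (frob_nabla_skew u).
by rewrite (frob_nabla_skew v (nabla u v)) opprK.
Qed.

(** Swapping [u] and [v] flips the sign of the bracket, and moving [nabla] across the inner product
    flips it back. This reduces the case of skew [u] to that of skew [v]. *)
Lemma frob_curvature_sym u v :
  frob (curvature u v v) u = frob (curvature v u u) v.
Proof.
rewrite !frob_curvature (frobC (nabla v v)) (frobC (nabla u v)).
by rewrite (frob_nabla_skew _ v) (bracketC u) nablaNl frobNr opprK (frobC v).
Qed.

Lemma frob_curvature_symmetric u v : u^T = u -> v^T = v ->
  frob (curvature u v v) u = - (7 / 4) * frob (bracket u v) (bracket u v).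
Proof.
move=> uT vT; set w := bracket u v.
have wT : w^T = - w by rewrite bracket_tr uT vT bracketC.
have nvv : nabla v v = 0 by rewrite nablaE vT !bracket_self !addr0 scaler0.
have nuv : nabla u v = 2^-1 *: w.
  by rewrite nablaE uT vT (bracketC v) addrK.
have nvu : nabla v u = - (2^-1 *: w).
  by rewrite nablaE uT vT (bracketC v) -addrA addNr addr0 scalerN.
(* Since [w] is skew and [v] symmetric, the three brackets in [nabla w v] all equal
   [- bracket v w]. *)
have nwv : nabla w v = - (2^-1 *: (bracket v w *+ 3)).
  rewrite nablaE wT vT bracketNr (bracketC w) -scalerN.
  by rewrite -!opprD -mulr2n -mulrSr.
rewrite frob_curvature nvv nuv nvu nwv frob0l oppr0 add0r.
rewrite -scaler_nat !(frobNl, frobNr, frobZl, frobZr).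
(* The adjoint of the bracket with [v] turns [<[v,w],u>] into [-|w|^2], so the total is
   [-1/4 - 3/2 = -7/4] times [|w|^2]. *)
rewrite frob_bracket vT (bracketC v) -/w frobNl.
by field.
Qed.

Lemma frob_curvature_skew u v : v^T = - v ->
  frob (curvature u v v) u = 4^-1 * frob (bracket u v) (bracket u v).
Proof.
move=> vT.
have nxv (x : 'M[R]_n) : nabla x v = 2^-1 *: bracket v x^T.
  by rewrite nablaE vT bracketNr addrN add0r.
have nvv : nabla v v = 0 by rewrite nxv vT bracketNr bracket_self oppr0 scaler0.
have nvu : nabla v u = bracket v u + 2^-1 *: bracket v u^T.
  rewrite nablaE vT bracketNr -bracketC addrAC scalerDr; congr (_ + _).
  by rewrite -mulr2n -scaler_nat scalerA mulVf ?scale1r // pnatr_eq0.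
rewrite frob_curvature nvv nvu !nxv frob0l oppr0 add0r.
have brE : (bracket u v)^T = - bracket v u^T.
  by rewrite bracket_tr vT (bracketC v) bracketC bracketNr.
(* The norm of [[u,v]] is that of its transpose, hence that of [a = [v,u^T]]. *)
rewrite -(frob_tr (bracket u v)) brE bracketNr scalerN !(frobNl, frobZl).
rewrite (frob_bracket _ v (bracket v u^T)) vT bracketNl.
(* What remains is [<a/2, b + a/2> - <b,a>/2]: the cross terms cancel and leave [|a|^2 / 4]. *)
move: (bracket v u^T) (bracket v u) => a b.
rewrite !(frobNl, frobNr, frobZl, frobZr, frobDr) (frobC b).
by field.
Qed.

End Curvature.

Theorem theorem3p2 (R : realType) (n : nat) (u v : 'M[R]_n)
    (huv : free [:: u; v])
    (hsym : (u^T = u /\ v^T = v) \/ (u^T = - u \/ v^T = - v)) :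
  bracket u v = 0 <-> sectional u v = 0.
Proof.
(* Only [c != 0] matters from here on: the sign of the curvature differs between the cases, but its
   vanishing does not. *)
have [c c0 numE] : exists2 c : R, c != 0 &
    frob (curvature u v v) u = c * frob (bracket u v) (bracket u v).
  case: hsym => [[uT vT] | [uT | vT]].
  - exists (- (7 / 4)); last exact: frob_curvature_symmetric.
    by rewrite oppr_eq0 mulf_neq0 ?invr_eq0 ?pnatr_eq0.
  - exists 4^-1; first by rewrite invr_eq0 pnatr_eq0.
    rewrite frob_curvature_sym frob_curvature_skew //.
    by rewrite (bracketC v) frobNl frobNr opprK.
  - exists 4^-1; first by rewrite invr_eq0 pnatr_eq0.
    exact: frob_curvature_skew.
have sectE : (sectional u v == 0) = (bracket u v == 0).
  rewrite /sectional numE mulf_eq0 invr_eq0 (negPf (gram_neq0 huv)) orbF.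
  by rewrite mulf_eq0 (negPf c0) frob_eq0.
by split=> /eqP; [rewrite -sectE | rewrite sectE] => /eqP.
Qed.
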